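(* Let $\mu=(n,k,\mathbf{r},\mathbf{a})\in\Sigma$, with $\mathbf{r}=(r_1,\ldots,r_n)$ and $\mathbf{a}=(a_1,\ldots,a_n)$, and let $$P_{\mu}(t)=(t-a_1)\cdots(t-a_n)\in\mathbb{C}[t],\qquad Q_{\mu}(t)=t^{-|\mathbf{r}|}(t-a_1)^{r_1+1}\cdots(t-a_k)^{r_k+1}\in\mathbb{C}[t^{\pm1}].$$ Then the two-dimensional subspace $\mathfrak{s}(\mu)=\mathrm{span}_{\mathbb{C}}\{P_{\mu}(t)\partial,Q_{\mu}(t)\partial\}\subseteq\mathfrak{d}$ is a Lie subalgebra of $\mathfrak{d}$. Indeed, $$[P_{\mu}(t)\partial,Q_{\mu}(t)\partial]=c_{\mu}Q_{\mu}(t)\partial,$$ where $c_{\mu}=(-1)^{n+1}|\mathbf{r}|a_1\cdots a_n$.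
   Context: $\mathbb{N}$ is the set of positive integers, $\mathbb{C}^{\times}=\mathbb{C}\setminus\{0\}$. $\mathfrak{d}$ is the centreless Virasoro algebra over $\mathbb{C}$, i.e. the Lie algebra of derivations of $\mathbb{C}[t^{\pm1}]$; with $\partial=t\frac{d}{dt}$, every element of $\mathfrak{d}$ is uniquely $F(t)\partial$ with $F(t)\in\mathbb{C}[t^{\pm1}]$, and $[F\partial,G\partial]=t(FG'-GF')\partial$. For $n,k\in\mathbb{N}$ with $n\geqslant k$, let $\Gamma(n,k)=\{(r_1,\ldots,r_n)\in\mathbb{N}^k\times\{-1\}^{n-k} : r_1+\cdots+r_n\geqslant k\}$. For $\mathbf{r}=(r_1,\ldots,r_n)\in\Gamma(n,k)$ put $|\mathbf{r}|=r_1+\cdots+r_n$, $V(\mathbf{r})=\{(a_1,\ldots,a_n)\in\mathbb{C}^n : \sum_{j=1}^n r_ja_j^i=0 \text{ for } i=1,\ldots,n-1\}$, and $V(\mathbf{r})^{\times}=V(\mathbf{r})\cap(\mathbb{C}^{\times})^n$. Let $\Sigma=\{(n,k,\mathbf{r},\mathbf{a}) : n,k\in\mathbb{N},\ n\geqslant k,\ \mathbf{r}\in\Gamma(n,k),\ \mathbf{a}\in V(\mathbf{r})^{\times}\}$. *)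

(* Defs.v *)
From HB Require Import structures.
From mathcomp Require Import all_boot all_order all_algebra.
From mathcomp Require Import finmap monalg ring.
From mathcomp Require Import boolp classical_sets functions reals.
From mathcomp Require Export complex.

Set Implicit Arguments.
Unset Strict Implicit.
Unset Printing Implicit Defensive.

Import Order.TTheory GRing.Theory Num.Theory.
Local Open Scope ring_scope.

(* K[t, t^-1], as the monoid algebra of the additive group int over K.  The    *)
(* ring structure of monalg.v is not available here: a monomType has no units  *)
(* but 1, which excludes int.                                                  *)
Definition laurent (K : nzRingType) : Type := {malg K[int]}.

Section LaurentRing.
Context (K : comNzRingType).
Implicit Types f g h : laurent K.

HB.instance Definition _ := GRing.Lmodule.copy (laurent K) {malg K[int]}.

Definition lmonom (c : K) (i : int) : laurent K := << c *g i >>.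

Definition laurent_one : laurent K := lmonom 1 0.

Definition laurent_mul f g : laurent K :=
  \sum_(i <- msupp f) \sum_(j <- msupp g) lmonom (f@_i * g@_j) (i + j).

Let lmonom0 i : lmonom 0 i = 0. Proof. exact: monalgU0. Qed.

Let mulw (d1 d2 : {fset int}) f g :
  (msupp f `<=` d1)%fset -> (msupp g `<=` d2)%fset ->
  laurent_mul f g
    = \sum_(i <- d1) \sum_(j <- d2) lmonom (f@_i * g@_j) (i + j).
Proof.
move=> le_d1 le_d2; rewrite /laurent_mul (big_fset_incl _ le_d1) /=.
  apply/eq_bigr=> k1 _; apply/big_fset_incl => // k _ /mcoeff_outdom ->.
  by rewrite mulr0 lmonom0.
move=> k _ /mcoeff_outdom fk.
by rewrite big1 // => k' _; rewrite fk mul0r lmonom0.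
Qed.

Let mulC : commutative laurent_mul.
Proof.
move=> f g; rewrite /laurent_mul exchange_big /=.
by apply/eq_bigr => i _; apply/eq_bigr => j _; rewrite mulrC addrC.
Qed.

Let mulDl : left_distributive laurent_mul +%R.
Proof.
move=> f1 f2 g.
have sub1 := fsubsetUl (msupp f1) (msupp f2).
have sub2 := fsubsetUr (msupp f1) (msupp f2).
rewrite (mulw sub1 (fsubset_refl _)) (mulw sub2 (fsubset_refl _)).
rewrite (mulw (msuppD_le _ _) (fsubset_refl _)) -big_split /=.
apply/eq_bigr => i _; rewrite -big_split /=; apply/eq_bigr => j _.
by rewrite mcoeffD mulrDl; exact: monalgUD.
Qed.

Let mul0l : left_zero 0 laurent_mul.
Proof. by move=> g; rewrite /laurent_mul msupp0 big_seq_fset0. Qed.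

Lemma lmonomE f : f = \sum_(i <- msupp f) lmonom (f@_i) i.
Proof. exact: monalgE. Qed.

Let mulUU a b i j :
  laurent_mul (lmonom a i) (lmonom b j) = lmonom (a * b) (i + j).
Proof.
by rewrite (mulw msuppU_le msuppU_le) !big_seq_fset1 !mcoeffUU.
Qed.

Lemma laurent_ind (P : laurent K -> Prop) :
  P 0 -> (forall f g, P f -> P g -> P (f + g)) ->
  (forall a i, P (lmonom a i)) -> forall f, P f.
Proof. by move=> P0 PD PU f; rewrite (lmonomE f); apply: big_ind. Qed.

Let mulDr : right_distributive laurent_mul +%R.
Proof. by move=> f g h; rewrite mulC mulDl !(mulC f). Qed.

Let mul0r' : right_zero 0 laurent_mul.
Proof. by move=> f; rewrite mulC mul0l. Qed.

Let mul1l : left_id laurent_one laurent_mul.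
Proof.
elim/laurent_ind => [|f g IHf IHg|a i]; first exact: mul0r'.
  by rewrite mulDr IHf IHg.
by rewrite mulUU mul1r add0r.
Qed.

Let mulA : associative laurent_mul.
Proof.
elim/laurent_ind => [g h|f1 f2 IH1 IH2 g h|a i]; first by rewrite !mul0l.
  by rewrite !mulDl IH1 IH2.
elim/laurent_ind => [h|g1 g2 IH1 IH2 h|b j]; first by rewrite mul0r' !mul0l mul0r'.
  by rewrite mulDl !mulDr mulDl IH1 IH2.
elim/laurent_ind => [|h1 h2 IH1 IH2|c k]; first by rewrite !mul0r'.
  by rewrite !mulDr IH1 IH2.
by rewrite !mulUU mulrA addrA.
Qed.

Let one_neq0 : laurent_one != 0.
Proof.
apply/eqP => /(congr1 (mcoeff 0)); rewrite mcoeffUU mcoeff0.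
by move/eqP; rewrite oner_eq0.
Qed.

HB.instance Definition _ := GRing.Zmodule_isComNzRing.Build (laurent K)
  mulA mulC mul1l mulDl one_neq0.

Lemma scale_lmonom (c a : K) i : c *: lmonom a i = lmonom (c * a) i.
Proof.
by apply/malgP => k; rewrite mcoeffZ !mcoeffU mulrnAr.
Qed.

Let scaleAl (c : K) f g : c *: (f * g) = (c *: f) * g.
Proof.
elim/laurent_ind: f => [|f1 f2 IH1 IH2|a i]; first by rewrite mul0r !scaler0 mul0r.
  by rewrite mulrDl !scalerDr IH1 IH2 mulrDl.
elim/laurent_ind: g => [|g1 g2 IH1 IH2|b j]; first by rewrite !mulr0 scaler0.
  by rewrite mulrDr scalerDr IH1 IH2 mulrDr.
rewrite scale_lmonom; apply: etrans (esym (mulUU _ _ _ _)).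
by rewrite -mulrA -scale_lmonom; congr (_ *: _); exact: mulUU.
Qed.

HB.instance Definition _ := GRing.Lmodule_isLalgebra.Build K (laurent K) scaleAl.
HB.instance Definition _ := GRing.Lalgebra_isComAlgebra.Build K (laurent K).

Lemma lmonomM a b i j : lmonom a i * lmonom b j = lmonom (a * b) (i + j).
Proof. exact: mulUU. Qed.

(* The power t ^ i for i : int.                                                *)
Definition lpow (i : int) : laurent K := lmonom 1 i.

Definition laurent_of_poly (p : {poly K}) : laurent K := horner_alg (lpow 1) p.

End LaurentRing.

HB.mixin Record Lmodule_isLie (K : nzRingType) L of GRing.Lmodule K L := {
  lie : L -> L -> L;
  lie_linearl : forall z, linear (lie^~ z);
  lie_linearr : forall x, linear (lie x);
  liexx : forall x, lie x x = 0;
  lie_jacobi : forall x y z,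
    lie x (lie y z) + lie y (lie z x) + lie z (lie x y) = 0
}.

#[short(type="lieType")]
HB.structure Definition Lie (K : nzRingType) :=
  { L of GRing.Lmodule K L & Lmodule_isLie K L }.

Notation "[ 'lie' x , y ]" := (lie x y)
  (at level 0, x, y at level 99, format "[ 'lie'  x ,  y ]") : ring_scope.

Definition lie_subalgebra (K : nzRingType) (L : lieType K) (S : set L) : Prop :=
  [/\ S 0, forall (a : K) x y, S x -> S y -> S (a *: x + y)
    & forall x y, S x -> S y -> S [lie x, y]].

Section Span.
Context (K : nzRingType) (V : lmodType K).

Definition lspan m (b : m.-tuple V) : set V :=
  [set x | exists c : 'I_m -> K, x = \sum_(i < m) c i *: tnth b i].

Definition lfree m (b : m.-tuple V) : Prop :=
  forall c : 'I_m -> K, \sum_(i < m) c i *: tnth b i = 0 -> forall i, c i = 0.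

Definition has_dim (S : set V) (m : nat) : Prop :=
  exists b : m.-tuple V, lfree b /\ lspan b = S.

End Span.

Section Derivations.
Context (K : comNzRingType) (A : comAlgType K).

Definition derivation : {pred A -> A} := fun D =>
  `[< linear D /\ forall f g, D (f * g) = D f * g + f * D g >].

Lemma derivationP (D : A -> A) :
  reflect (linear D /\ forall f g, D (f * g) = D f * g + f * D g)
          (D \in derivation).
Proof. exact: asboolP. Qed.

Lemma derivation_submod : submod_closed derivation.
Proof.
split.
  apply/derivationP; split=> [a f g|f g].
    by rewrite -[RHS]/(a *: 0 + 0) scaler0 addr0.
  by rewrite -[RHS]/(0 * g + f * 0) mul0r mulr0 addr0.
move=> a D E /derivationP[linD DM] /derivationP[linE EM].
apply/derivationP; split=> [b f g|f g].
  rewrite -[LHS]/(a *: D (b *: f + g) + E (b *: f + g)).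
  rewrite -[RHS]/(b *: (a *: D f + E f) + (a *: D g + E g)).
  by rewrite linD linE !scalerDr !scalerA (mulrC a b) addrACA.
rewrite -[LHS]/(a *: D (f * g) + E (f * g)).
rewrite -[RHS]/((a *: D f + E f) * g + f * (a *: D g + E g)).
by rewrite DM EM scalerDr mulrDl mulrDr scalerAl scalerAr addrACA.
Qed.

HB.instance Definition _ :=
  GRing.isSubmodClosed.Build K (A -> A) derivation derivation_submod.

Record der : Type := Der { der_fun :> A -> A; _ : der_fun \in derivation }.

HB.instance Definition _ := [isSub for der_fun].
HB.instance Definition _ := [Choice of der by <:].
HB.instance Definition _ := [SubChoice_isSubLmodule of der by <:].

Lemma derP (D E : der) : (forall f, D f = E f) -> D = E.
Proof. by move=> eqDE; apply/val_inj/funext. Qed.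

Let derL (D : der) : linear D.
Proof. by case: D => D /= /derivationP[]. Qed.

Lemma derM (D : der) f g : D (f * g) = D f * g + f * D g.
Proof. by case: D => D /= /derivationP[]. Qed.

HB.instance Definition _ (D : der) :=
  GRing.isLinear.Build K A A *:%R (der_fun D) (derL D).

Lemma der_add (D E : der) f : (D + E) f = D f + E f. Proof. by []. Qed.
Lemma der_scale a (D : der) f : (a *: D) f = a *: D f. Proof. by []. Qed.
Lemma der_zero f : (0 : der) f = 0. Proof. by []. Qed.

Lemma der_lie_subproof (D E : der) :
  (fun f => D (E f) - E (D f)) \in derivation.
Proof.
apply/derivationP; split=> [a f g|f g].
  by rewrite !linearP /= scalerBr scalerN addrACA.
by rewrite !derM !linearD /= !derM; ring.
Qed.

Definition der_lie (D E : der) : der := Der (der_lie_subproof D E).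

Let lie_linl (E : der) : linear (der_lie^~ E).
Proof.
move=> a D D'; apply: derP => f; rewrite der_add der_scale /=.
by rewrite linearP /= scalerBr opprD addrACA.
Qed.

Let lie_linr (D : der) : linear (der_lie D).
Proof.
move=> a E E'; apply: derP => f; rewrite der_add der_scale /=.
by rewrite linearP /= scalerBr opprD addrACA.
Qed.

Let lie_alt (D : der) : der_lie D D = 0.
Proof. by apply: derP => f /=; rewrite subrr. Qed.

Let lie_jac (D E F : der) :
  der_lie D (der_lie E F) + der_lie E (der_lie F D) + der_lie F (der_lie D E) = 0.
Proof.
by apply: derP => f; rewrite !der_add der_zero /= !linearB /=; ring.
Qed.

HB.instance Definition _ :=
  Lmodule_isLie.Build K der lie_linl lie_linr lie_alt lie_jac.

Lemma der_lieE (D E : der) f : [lie D, E] f = D (E f) - E (D f).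
Proof. by []. Qed.

Lemma mul_der_subproof (F : A) (D : der) : (fun f => F * D f) \in derivation.
Proof.
apply/derivationP; split=> [a f g|f g].
  by rewrite linearP mulrDr scalerAr.
by rewrite derM mulrDr mulrA (mulrCA F f).
Qed.

Definition mul_der (F : A) (D : der) : der := Der (mul_der_subproof F D).

End Derivations.

Notation virasoro K := (der (laurent K)).

Section Virasoro.
Context (K : comNzRingType).

Definition laurent_deriv (f : laurent K) : laurent K :=
  \sum_(i <- msupp f) lmonom (f@_i *~ i) (i - 1).

Let derivw (d : {fset int}) (f : laurent K) : (msupp f `<=` d)%fset ->
  laurent_deriv f = \sum_(i <- d) lmonom (f@_i *~ i) (i - 1).
Proof.
move=> le_d; apply/big_fset_incl => // i _ /mcoeff_outdom ->.
by rewrite mul0rz; exact: monalgU0.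
Qed.

Lemma lmonomD (a b : K) i : lmonom (a + b) i = lmonom a i + lmonom b i.
Proof. exact: monalgUD. Qed.

Lemma laurent_deriv_lmonom (a : K) i :
  laurent_deriv (lmonom a i) = lmonom (a *~ i) (i - 1).
Proof. by rewrite (derivw msuppU_le) big_seq_fset1 mcoeffUU. Qed.

Let derivD : {morph laurent_deriv : f g / f + g}.
Proof.
move=> f g; rewrite (derivw (fsubsetUl (msupp f) (msupp g))).
rewrite (derivw (fsubsetUr (msupp f) (msupp g))) (derivw (msuppD_le f g)).
rewrite -big_split /=; apply/eq_bigr => i _.
by rewrite mcoeffD mulrzDl lmonomD.
Qed.

Let deriv0 : laurent_deriv 0 = 0.
Proof. by rewrite /laurent_deriv msupp0 big_seq_fset0. Qed.

Lemma laurent_deriv_subproof : laurent_deriv \in @derivation K (laurent K).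
Proof.
apply/derivationP; split=> [a f g|].
  rewrite derivD; congr (_ + _).
  elim/laurent_ind: f => [|f1 f2 IH1 IH2|b i]; first by rewrite !(scaler0, deriv0).
    by rewrite scalerDr !derivD IH1 IH2 scalerDr.
  by rewrite scale_lmonom !laurent_deriv_lmonom scale_lmonom -mulrzAr.
elim/laurent_ind => [g|f1 f2 IH1 IH2 g|a i].
- by rewrite !(mul0r, deriv0) addr0.
- by rewrite mulrDl !derivD IH1 IH2 !mulrDl addrACA.
elim/laurent_ind => [|g1 g2 IH1 IH2|b j].
- by rewrite !(mulr0, deriv0) addr0.
- by rewrite mulrDr !derivD IH1 IH2 !mulrDr addrACA.
rewrite lmonomM !laurent_deriv_lmonom !lmonomM.
rewrite (addrAC i (- 1) j) (addrA i j) -lmonomD; congr lmonom.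
by rewrite mulrzDr mulrzAl mulrzAr.
Qed.

Definition ddt : virasoro K := Der laurent_deriv_subproof.

Definition euler : virasoro K := mul_der (lpow K 1) ddt.

(* The derivation F(t) t d/dt; every derivation is of this form.               *)
Definition vir (F : laurent K) : virasoro K := mul_der F euler.

Lemma lie_vir (F G : laurent K) :
  [lie vir F, vir G] = vir (lpow K 1 * (F * ddt G - G * ddt F)).
Proof.
apply: derP => f; rewrite der_lieE.
rewrite -[LHS]/(F * (lpow K 1 * ddt (G * (lpow K 1 * ddt f)))
                 - G * (lpow K 1 * ddt (F * (lpow K 1 * ddt f)))).
rewrite -[RHS]/(lpow K 1 * (F * ddt G - G * ddt F) * (lpow K 1 * ddt f)).
by rewrite !(derM _ F) !(derM _ G); ring.
Qed.

End Virasoro.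

Section Sigma.
Context (K : comNzRingType).
Variables (n k : nat).
Implicit Types (r : 'I_n -> int) (a : 'I_n -> K).
Local Open Scope classical_set_scope.

Definition weight r : int := \sum_(i < n) r i.

(* Indices are shifted: r_1, ..., r_k are the r i with (i < k)%N.              *)
Definition Gamma : set ('I_n -> int) :=
  [set r | [/\ forall i : 'I_n, (i < k)%N -> 0 < r i,
               forall i : 'I_n, (k <= i)%N -> r i = -1
             & k%:Z <= weight r]].

Definition V r : set ('I_n -> K) :=
  [set a | forall i : nat, (1 <= i <= n - 1)%N ->
     \sum_(j < n) (r j)%:~R * a j ^+ i = 0].

Definition Vx r : set ('I_n -> K) := V r `&` [set a | forall j, a j != 0].

Definition Sigma r a : Prop :=
  [/\ (0 < n)%N, (0 < k)%N, (k <= n)%N, Gamma r & Vx r a].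

Definition P_mu a : {poly K} := \prod_(i < n) ('X - (a i)%:P).

(* On Gamma the exponents r_i + 1 with (i < k)%N are positive, so that absz    *)
(* only casts them to nat.                                                     *)
Definition Q_mu r a : laurent K :=
  lpow K (- weight r) *
  laurent_of_poly (\prod_(i < n | (i < k)%N) ('X - (a i)%:P) ^+ absz (r i + 1)).

Definition s_mu r a : set (virasoro K) :=
  lspan [tuple vir (laurent_of_poly (P_mu a)); vir (Q_mu r a)].

Definition c_mu r a : K := (-1) ^+ n.+1 * (weight r)%:~R * \prod_(i < n) a i.

End Sigma.

(* Main.v *)
(* With [w = |r|], [P_j = P / (t - a_j)] and [Q = t^(-w) S]: since
   [P S' = S * sum_(i <= k) (r_i + 1) P_i], [P' = sum_i P_i] and [r_i + 1 = 0]
   for [i > k], the bracket [[P d, Q d]] is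
   [t^(-w) S (t * sum_i r_i P_i - w P) d].  The coefficients of [P_j] are those
   of [P] combined with powers of [a_j], so that the vanishing power sums leave
   [t * sum_i r_i P_i = w (P - P(0))], and the last factor is [- w P(0) = c].
   As [c] and [Q] are nonzero, bracketing a linear relation between [P d] and
   [Q d] with each of them shows that it is trivial. *)

From HB Require Import structures.
Require Import Defs.
From mathcomp Require Import all_boot all_order all_algebra.
From mathcomp Require Import zify ring monalg reals.

Import Order.TTheory GRing.Theory Num.Theory.
Local Open Scope ring_scope.

Section PowerSums.
Variables (K : comNzRingType) (n : nat) (a : 'I_n -> K).

Local Notation P := (\prod_(i < n) ('X - (a i)%:P)).
Local Notation Pc j := (\prod_(i < n | i != j) ('X - (a i)%:P)).

Lemma prod_XsubC_cofactor j : P = ('X - (a j)%:P) * Pc j.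
Proof. by rewrite (bigD1 j). Qed.

Lemma size_cofactor j : size (Pc j) = n.
Proof.
have := size_prod_XsubC (enum 'I_n) a.
rewrite big_enum size_enum_ord /= (prod_XsubC_cofactor j) mulrC.
rewrite size_Mmonic ?monicXsubC ?monic_neq0 ?monic_prod_XsubC //.
by rewrite size_XsubC addn2 /= => -[->].
Qed.

Lemma coef_cofactor j m : (Pc j)`_m = P`_m.+1 + a j * (Pc j)`_m.+1.
Proof. by rewrite (prod_XsubC_cofactor j) mulrBl coefB coefXM coefCM /= subrK. Qed.

Lemma sum_cofactor_power_sums (w : 'I_n -> K) :
    (forall s, (0 < s < n)%N -> \sum_j w j * a j ^+ s = 0) ->
  'X * \sum_j w j *: Pc j = (\sum_j w j) *: (P - (P`_0)%:P).
Proof.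
move=> sums0; pose T s m := \sum_j w j * a j ^+ s * (Pc j)`_m.
have TS s m : T s m = (\sum_j w j * a j ^+ s) * P`_m.+1 + T s.+1 m.+1.
  rewrite mulr_suml -big_split; apply: eq_bigr => j _ /=.
  by rewrite coef_cofactor mulrDr exprSr !mulrA.
(* [TS] moves up both indices: at [m >= n] the coefficients vanish, and before
   that the power sum does. *)
have T0 d s m : (n - m <= d)%N -> (0 < s <= m)%N -> T s m = 0.
  elim: d s m => [|d IHd] s m le_nmd /andP[s_gt0 le_sm].
    apply: big1 => j _; rewrite nth_default ?mulr0 // size_cofactor.
    by rewrite -subn_eq0 -leqn0.
  have [le_nm|lt_mn] := leqP n m.
    by apply: big1 => j _; rewrite nth_default ?mulr0 // size_cofactor.
  rewrite TS sums0 ?mul0r ?add0r ?s_gt0 ?(leq_ltn_trans le_sm) //.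
  by apply: IHd => //; rewrite subnS; case: (n - m)%N le_nmd.
apply/polyP => -[|m]; rewrite coefXM coefZ coefB coefC /= ?subrr ?mulr0 //.
rewrite subr0 coef_sum.
have -> : \sum_j (w j *: Pc j)`_m = T 0 m.
  by apply: eq_bigr => j _; rewrite coefZ mulr1.
rewrite TS (T0 _ _ _ (leqnn _)) // addr0; congr (_ * _).
by apply: eq_bigr => j _; rewrite mulr1.
Qed.

Lemma coef0_prod_XsubC_ord : P`_0 = (-1) ^+ n * \prod_i a i.
Proof.
rewrite -horner_coef0 horner_prod.
under eq_bigr do rewrite hornerXsubC sub0r.
by rewrite prodrN card_ord.
Qed.

(* The logarithmic derivative rule, with [p] a common denominator. *)
Lemma deriv_prod_log (I : Type) (s : seq I) (Q : pred I)
    (p : {poly K}) (f g : I -> {poly K}) :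
    (forall i, Q i -> p * (f i)^`() = f i * g i) ->
  p * (\prod_(i <- s | Q i) f i)^`() =
    (\prod_(i <- s | Q i) f i) * \sum_(i <- s | Q i) g i.
Proof.
move=> fg; elim/big_rec2: _ => [|i y z Qi IH]; first by rewrite derivC !mulr0.
by rewrite derivM mulrDr mulrA fg // mulrCA IH mulrDr mulrA [f i * _ * z]mulrAC.
Qed.

Lemma deriv_prod_XsubC_exp (Q : pred 'I_n) (e : 'I_n -> nat) :
  let S := \prod_(i | Q i) ('X - (a i)%:P) ^+ e i in
  P * S^`() = S * \sum_(i | Q i) (e i)%:R *: Pc i.
Proof.
apply: deriv_prod_log => i _; rewrite deriv_exp derivXsubC mul1r.
case: (e i) => [|m]; first by rewrite mulr0n scale0r !mulr0.
by rewrite (prod_XsubC_cofactor i) scaler_nat !mulrnAr exprS mulrAC.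
Qed.

Lemma deriv_prod_XsubC : P^`() = \sum_i Pc i.
Proof.
apply: (monic_lreg (monic_prod_XsubC (index_enum 'I_n) predT a)).
have /= := deriv_prod_XsubC_exp predT (fun=> 1%N).
rewrite (eq_bigr _ (fun i _ => expr1 ('X - (a i)%:P))) /= => ->.
by congr (_ * _); apply: eq_bigr => i _; rewrite scale1r.
Qed.

Lemma deriv_prod_XsubC_bracket (Q : pred 'I_n) (e : 'I_n -> nat) (w : 'I_n -> K) :
    (forall s, (0 < s < n)%N -> \sum_j w j * a j ^+ s = 0) ->
    (forall i, w i = (if Q i then e i else 0)%:R - 1) ->
  let S := \prod_(i | Q i) ('X - (a i)%:P) ^+ e i in
  'X * (P * S^`() - S * P^`()) - (\sum_j w j) *: (P * S)
    = ((-1) ^+ n.+1 * (\sum_j w j) * \prod_i a i) *: S.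
Proof.
move=> sums0 we S; rewrite deriv_prod_XsubC_exp deriv_prod_XsubC -mulrBr.
have -> : \sum_(i | Q i) (e i)%:R *: Pc i - \sum_i Pc i = \sum_i w i *: Pc i.
  rewrite big_mkcond -sumrB; apply: eq_bigr => i _; rewrite we.
  by case: (Q i); rewrite ?scalerBl ?scale1r ?scale0r.
rewrite mulrCA sum_cofactor_power_sums // coef0_prod_XsubC_ord.
rewrite -/S -!mul_polyC exprS !polyCM polyCN; move: P S => p q; ring.
Qed.

End PowerSums.

Lemma derD (K : comNzRingType) (A : comAlgType K) (D : der A) f g :
  D (f + g) = D f + D g.
Proof. exact: linearD. Qed.

Section LaurentPoly.
Variable K : comNzRingType.
Implicit Types (p q : {poly K}) (F G : laurent K).

HB.instance Definition _ :=
  GRing.LRMorphism.copy (@laurent_of_poly K) (horner_alg (lpow K 1)).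

Lemma laurent_of_polyX : laurent_of_poly 'X = lpow K 1.
Proof. exact: horner_algX. Qed.

Lemma laurent_of_polyC c : laurent_of_poly c%:P = c%:A :> laurent K.
Proof. exact: horner_algC. Qed.

Lemma laurent_of_polyZ c p : laurent_of_poly (c *: p) = c *: laurent_of_poly p.
Proof. by rewrite linearZ /= mulr_algl. Qed.

Lemma laurent_of_polyB p q :
  laurent_of_poly (p - q) = laurent_of_poly p - laurent_of_poly q.
Proof. exact: rmorphB. Qed.

Lemma laurent_of_polyM p q :
  laurent_of_poly (p * q) = laurent_of_poly p * laurent_of_poly q.
Proof. exact: rmorphM. Qed.

Lemma lpowD i j : lpow K (i + j) = lpow K i * lpow K j.
Proof. by rewrite lmonomM mulr1. Qed.

Lemma lpowXn i : lpow K 1 ^+ i = lpow K i%:Z.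
Proof. by elim: i => [|i IHi] //; rewrite exprS IHi -lpowD -intS. Qed.

Lemma mcoeff_laurent_of_poly p (i : nat) : (laurent_of_poly p)@_(i%:Z) = p`_i.
Proof.
rewrite -[p in LHS]coefK poly_def linear_sum raddf_sum /=.
rewrite -[p in RHS]coefK poly_def coef_sum; apply: eq_bigr => j _.
rewrite laurent_of_polyZ rmorphXn /= laurent_of_polyX lpowXn scale_lmonom.
by rewrite [LHS]mcoeffU coefZ coefXn mulr1 eqz_nat eq_sym mulr_natr.
Qed.

Lemma laurent_of_poly_inj : injective (@laurent_of_poly K).
Proof. by move=> p q E; apply/polyP => i; rewrite -!mcoeff_laurent_of_poly E. Qed.

Lemma ddt_lpow i : lpow K 1 * ddt K (lpow K i) = i%:~R *: lpow K i.
Proof.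
rewrite [ddt K _]laurent_deriv_lmonom lmonomM scale_lmonom mul1r mulr1.
by rewrite addrCA subrr addr0.
Qed.

Lemma ddt_laurent_of_poly p : ddt K (laurent_of_poly p) = laurent_of_poly p^`().
Proof.
have ddtX : ddt K (lpow K 1) = 1.
  by rewrite [LHS]laurent_deriv_lmonom subrr.
have ddtC c : ddt K c%:A = 0.
  by rewrite scale_lmonom [LHS]laurent_deriv_lmonom; exact: monalgU0.
elim/poly_ind: p => [|p c IHp]; first by rewrite deriv0 !linear0.
rewrite derivMXaddC !rmorphD !rmorphM /= laurent_of_polyX laurent_of_polyC.
by rewrite -[laurent_deriv _]/(ddt K _) derD ddtC addr0 derM IHp ddtX mulr1 addrC.
Qed.

Lemma scale_vir c F : vir (c *: F) = c *: vir F.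
Proof. by apply: derP => f; rewrite der_scale -[LHS]/(c *: F * _) -scalerAl. Qed.

Lemma vir_eq0 F : vir F = 0 -> F = 0.
Proof.
move/(congr1 (fun D : virasoro K => D (lpow K 1))).
rewrite der_zero -[X in X = _]/(F * (lpow K 1 * ddt K (lpow K 1))) ddt_lpow.
rewrite scale1r => /(congr1 ( *%R^~ (lpow K (- 1)))).
by rewrite mul0r -mulrA -lpowD subrr mulr1.
Qed.

Lemma lie_vir_lpow_poly p q (w : int) c :
    'X * (p * q^`() - q * p^`()) - w%:~R *: (p * q) = c *: q ->
  let Q := lpow K (- w) * laurent_of_poly q in
  [lie vir (laurent_of_poly p), vir Q] = c *: vir Q.
Proof.
move=> pq Q; rewrite lie_vir -scale_vir; congr vir.
rewrite /Q scalerAr -laurent_of_polyZ -pq derM ddt_laurent_of_poly.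
rewrite ddt_laurent_of_poly laurent_of_polyB laurent_of_polyZ !laurent_of_polyM.
rewrite laurent_of_polyB !laurent_of_polyM laurent_of_polyX.
have := ddt_lpow (- w); rewrite mulrNz scaleNr => E.
set A := laurent_of_poly p; set B := laurent_of_poly q.
set A' := laurent_of_poly p^`(); set B' := laurent_of_poly q^`().
transitivity (A * B * (lpow K 1 * ddt K (lpow K (- w)))
    + lpow K (- w) * (lpow K 1 * (A * B' - B * A'))); first by ring.
rewrite E addrC [in RHS]mulrBr; congr (_ + _).
by rewrite mulrN -!scalerAr [A * B * _]mulrC.
Qed.

End LaurentPoly.

Section LieSpan2.
Variables (K : comNzRingType) (L : lieType K).
Implicit Types (x y z : L) (a b c : K).

Lemma lspan2P x y z :
  lspan [tuple x; y] z <-> exists a b, z = a *: x + b *: y.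
Proof.
split=> [[c ->]|[a [b ->]]].
  exists (c ord0), (c (lift ord0 ord0)).
  by rewrite !big_ord_recl big_ord0 addr0.
exists (fun i => if i == ord0 then a else b).
by rewrite !big_ord_recl big_ord0 addr0.
Qed.

Lemma lie0l z : [lie 0, z] = 0.
Proof.
have := lie_linearl z 1 0 0; rewrite !scale1r addr0.
by rewrite -[X in X = _]addr0 => /addrI.
Qed.

Lemma lie0r z : [lie z, 0] = 0.
Proof.
have := lie_linearr z 1 0 0; rewrite !scale1r addr0.
by rewrite -[X in X = _]addr0 => /addrI.
Qed.

Lemma lie_lin2l a b x y z :
  [lie a *: x + b *: y, z] = a *: [lie x, z] + b *: [lie y, z].
Proof.
by rewrite lie_linearl -[b *: y]addr0 lie_linearl lie0l addr0.
Qed.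

Lemma lie_lin2r a b x y z :
  [lie z, a *: x + b *: y] = a *: [lie z, x] + b *: [lie z, y].
Proof.
by rewrite lie_linearr -[b *: y]addr0 lie_linearr lie0r addr0.
Qed.

Lemma lieC x y : [lie x, y] = - [lie y, x].
Proof.
apply/eqP; rewrite -addr_eq0; apply/eqP.
have := liexx (1 *: x + 1 *: y); rewrite lie_lin2l !lie_lin2r !liexx !scale1r.
by rewrite add0r addr0.
Qed.

Lemma lie_subalgebra_span2 x y c :
  [lie x, y] = c *: y -> lie_subalgebra (lspan [tuple x; y]).
Proof.
move=> xy; split.
- by apply/lspan2P; exists 0, 0; rewrite !scale0r addr0.
- move=> a u v /lspan2P[a1 [b1 ->]] /lspan2P[a2 [b2 ->]]; apply/lspan2P.
  exists (a * a1 + a2), (a * b1 + b2).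
  by rewrite scalerDr !scalerDl !scalerA addrACA.
move=> u v /lspan2P[a1 [b1 ->]] /lspan2P[a2 [b2 ->]]; apply/lspan2P.
exists 0, ((a1 * b2 - b1 * a2) * c); rewrite scale0r add0r.
rewrite lie_lin2l !lie_lin2r !liexx (lieC y) xy !scaler0 add0r addr0.
by rewrite !scalerN !scalerA mulrBl scalerBl.
Qed.

End LieSpan2.

Lemma has_dim_lspan2 (K : fieldType) (L : lieType K) (x y : L) (c : K) :
  [lie x, y] = c *: y -> c != 0 -> y != 0 -> has_dim (lspan [tuple x; y]) 2.
Proof.
move=> xy c0 y0; have scy0 b : b *: (c *: y) = 0 -> b = 0.
  by move/eqP; rewrite scalerA scaler_eq0 (negPf y0) orbF mulf_eq0 (negPf c0) orbF
    => /eqP.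
exists [tuple x; y]; split=> // b.
rewrite !big_ord_recl big_ord0 addr0 !(tnth_nth 0) /= => b0.
have b2 : b (lift ord0 ord0) = 0.
  by apply: scy0; have := lie0r _ _ x; rewrite -b0 lie_lin2r liexx xy scaler0 add0r.
have b1 : b ord0 = 0.
  by apply: scy0; have := lie0l _ _ y; rewrite -b0 lie_lin2l liexx xy scaler0 addr0.
case=> [[|[|//]]] lt_i.
  by rewrite -[RHS]b1; congr b; exact: val_inj.
by rewrite -[RHS]b2; congr b; exact: val_inj.
Qed.

Theorem proposition2p2 (R : realType) (n k : nat)
    (r : 'I_n -> int) (a : 'I_n -> R[i]) (mu : Sigma k r a) :
  [/\ has_dim (s_mu k r a) 2,
      lie_subalgebra (s_mu k r a)
    & [lie vir (laurent_of_poly (P_mu a)), vir (Q_mu k r a)]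
        = c_mu r a *: vir (Q_mu k r a)].
Proof.
case: mu => n0 k0 kn [rpos rneg kw] [sums0 an0].
have PQ : [lie vir (laurent_of_poly (P_mu a)), vir (Q_mu k r a)]
        = c_mu r a *: vir (Q_mu k r a).
  apply: lie_vir_lpow_poly; rewrite /c_mu /weight rmorph_sum /=.
  apply: deriv_prod_XsubC_bracket => [s s_n|i].
    apply: sums0; lia.
  case: ltnP => [/rpos r_gt0|/rneg ->]; last first.
    by rewrite mulrN1z sub0r.
  by rewrite natr_absz gtr0_norm ?rmorphD /= ?addrK // addr_gt0.
have c0 : c_mu r a != 0.
  rewrite !mulf_neq0 ?signr_eq0 ?intr_eq0 //.
    by rewrite gt_eqF // (lt_le_trans _ kw).
  by apply/prodf_neq0 => i _; exact: an0.
split=> //; last exact: lie_subalgebra_span2 PQ.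
apply: has_dim_lspan2 PQ c0 _; apply/eqP => /vir_eq0.
move/(congr1 ( *%R (lpow _ (weight r)))).
rewrite mulrA -lpowD subrr mul1r mulr0 -(linear0 (laurent_of_poly (K:=R[i]))).
move/laurent_of_poly_inj => /eqP; apply/negP.
by apply/prodf_neq0 => i _; rewrite expf_neq0 // polyXsubC_eq0.
Qed.
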